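(* Let $M$ be a matroid on a finite ground set $E$. The action of $\mathrm{Aut}(M)$ on the top reduced homology $\tilde{H}_{r(M)-1}(\Delta_M,\mathbb{Z})$ of the augmented Bergman complex is the same as (i.e. isomorphic, as a $\mathbb{Z}[\mathrm{Aut}(M)]$-module, to) its action on the top oriented simplicial chain group $\tilde{C}_{r(M)-1}(\mathcal{I}(M),\mathbb{Z})$ of the independent set complex $\mathcal{I}(M)$.
   Context: Let $M$ be a matroid on a finite set $E$, with independent sets $\mathcal{I}(M)$ (regarded as a simplicial complex of dimension $r(M)-1$ whose facets are the bases), lattice of flats $\mathcal{F}(M)$, and rank $r(M)$. The augmented Bergman complex $\Delta_M$ is the abstract simplicial complex on vertex set $\{y_i : i\in E\}\sqcup\{x_F : F\in\mathcal{F}(M)\setminus\{E\}\}$ whose simplices are the subsets $\{y_i\}_{i\in I}\cup\{x_{F_1},\ldots,x_{F_\ell}\}$ with $I\in\mathcal{I}(M)$, $\ell\ge 0$, and flats satisfying $I\subseteq F_1\subsetneq F_2\subsetneq\cdots\subsetneq F_\ell\ (\subsetneq E)$. It is pure of dimension $r(M)-1$. The automorphism group is $\mathrm{Aut}(M)=\{\text{bijections }\sigma:E\to E : \sigma(I)\in\mathcal{I}(M)\text{ for all }I\in\mathcal{I}(M)\}$. It acts simplicially on $\mathcal{I}(M)$, and on $\Delta_M$ via $y_i\mapsto y_{\sigma(i)}$, $x_F\mapsto x_{\sigma(F)}$, hence on reduced homology and on simplicial chains. For a simplicial complex $\Delta$, the oriented chain group $\tilde{C}_i(\Delta,\mathbb{Z})$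 is the free abelian group with one basis element $[v_0,\ldots,v_i]$ (an oriented simplex) for each $i$-dimensional simplex $\{v_0,\ldots,v_i\}$ with a fixed reference ordering of its vertices, with the convention $[v_{w(0)},\ldots,v_{w(i)}]=\mathrm{sgn}(w)[v_0,\ldots,v_i]$ for permutations $w$; simplicial automorphisms $g$ act by $g[v_0,\ldots,v_i]=[g(v_0),\ldots,g(v_i)]$. Reduced homology $\tilde H_*(\Delta,\mathbb{Z})$ is computed from the augmented chain complex, with $\tilde{C}_{-1}$ spanned by the empty simplex. *)

(* Defs.v *)
From HB Require Import structures.
From mathcomp Require Import all_boot all_order all_algebra all_fingroup.
From mathcomp Require Import boolp zify.
From mathcomp Require Import generic_quotient ring_quotient.

Set Implicit Arguments.
Unset Strict Implicit.
Unset Printing Implicit Defensive.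

Import GRing.Theory.
Local Open Scope ring_scope.
Local Open Scope quotient_scope.

Record complex (V : finType) := Complex {
  faces : {set {set V}};
  complex0 : set0 \in faces;
  complexS : forall s t : {set V}, s \in faces -> t \subset s -> t \in faces
}.

Definition simp_aut (V : finType) (D : complex V) : {set {perm V}} :=
  [set g : {perm V} | [forall s : {set V} in faces D, g @: s \in faces D]].

Section SimpAutTheory.
Variables (V : finType) (D : complex V).

Lemma simp_autP (g : {perm V}) :
  reflect (forall s : {set V}, s \in faces D -> g @: s \in faces D) (g \in simp_aut D).
Proof. by rewrite inE; apply: forall_inP. Qed.

Lemma simp_aut_group_set : group_set (simp_aut D).
Proof.
apply/group_setP; split.
  apply/simp_autP => s sD.
  by rewrite (_ : _ @: s = s) // -[RHS]imset_id; apply: eq_imset => x; rewrite perm1.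
move=> g h /simp_autP gD /simp_autP hD; apply/simp_autP => s sD.
rewrite (_ : _ @: s = h @: (g @: s)) ?hD ?gD //.
by rewrite -imset_comp; apply: eq_imset => x; rewrite permM.
Qed.
Canonical simp_aut_group := Group simp_aut_group_set.

Lemma simp_aut_faces (g : {perm V}) (s : {set V}) :
  g \in simp_aut D -> (g @: s \in faces D) = (s \in faces D).
Proof.
move=> gD; apply/idP/idP; last exact/simp_autP.
move=> /(simp_autP _ (groupVr gD)); rewrite -imset_comp.
by rewrite (_ : _ @: s = s) // -[RHS]imset_id; apply: eq_imset => x /=; rewrite permK.
Qed.

End SimpAutTheory.

Section Chains.
Variables (V : finType) (D : complex V).
Implicit Types (g h : {perm V}) (n : nat).

(* Everything below is indexed by the number n of vertices of a simplex, so
   that [simplex n] is the set of (n-1)-dimensional simplices; the empty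
   simplex is the unique element of [simplex 0]. *)
Definition simplex n := {s : {set V} | (s \in faces D) && (#|s| == n)}.
HB.instance Definition _ n := SubFinite.on (simplex n).

Lemma simplex_faces n (s : simplex n) : val s \in faces D.
Proof. by have /andP[] := valP s. Qed.

Lemma simplex_card n (s : simplex n) : #|val s| = n.
Proof. by have /andP[_ /eqP] := valP s. Qed.

(* The reference ordering of the vertices of s is that of [enum V]. *)
Definition vert n (s : simplex n) (i : 'I_n) : V :=
  enum_val (cast_ord (esym (simplex_card s)) i).

Definition chain n := {ffun simplex n -> int}.
HB.instance Definition _ n := GRing.Zmodule.on (chain n).

(* [bracket v] is the oriented simplex [v_0, ..., v_(n-1)]: it is sgn(w) times
   the basis element of s if (v_i) is the reference ordering of s permuted by
   w, and it is 0 if the v_i are not distinct or do not span a simplex. *)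
Definition bracket n (v : 'I_n -> V) : chain n :=
  [ffun s => \sum_(w : 'S_n | [forall i, v i == vert s (w i)]) (-1) ^+ w].

(* For n = 0 the inner sum is empty, and [bd] is the zero map. *)
Definition bd n (c : chain n) : chain n.-1 :=
  \sum_(s : simplex n)
    (\sum_(j < n) bracket (vert s \o lift j) *~ (-1) ^+ j) *~ c s.

Definition chain_act n g (c : chain n) : chain n :=
  \sum_(s : simplex n) bracket (g \o vert s) *~ c s.

Lemma bd_is_zmod_morphism n : zmod_morphism (@bd n).
Proof.
move=> c d; rewrite /bd -sumrB; apply: eq_bigr => s _.
by rewrite !ffunE mulrzBr.
Qed.
HB.instance Definition _ n :=
  GRing.isZmodMorphism.Build (chain n) (chain n.-1) (@bd n)
    (@bd_is_zmod_morphism n).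

Lemma chain_act_is_zmod_morphism n g : zmod_morphism (@chain_act n g).
Proof.
move=> c d; rewrite /chain_act -sumrB; apply: eq_bigr => s _.
by rewrite !ffunE mulrzBr.
Qed.
HB.instance Definition _ n g :=
  GRing.isZmodMorphism.Build (chain n) (chain n) (@chain_act n g)
    (@chain_act_is_zmod_morphism n g).

Lemma vert_inj n (s : simplex n) : injective (vert s).
Proof. by move=> i j /enum_val_inj /cast_ord_inj. Qed.

Lemma vert_in n (s : simplex n) i : vert s i \in val s.
Proof. exact: enum_valP. Qed.

Lemma vert_im n (s : simplex n) : vert s @: 'I_n = val s.
Proof.
apply/eqP; rewrite eqEcard card_imset; last exact: vert_inj.
rewrite card_ord simplex_card leqnn andbT.
by apply/subsetP => _ /imsetP[i _ ->]; exact: vert_in.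
Qed.

Lemma imset_perm n (v : 'I_n -> V) (w : 'S_n) : (v \o w) @: 'I_n = v @: 'I_n.
Proof.
apply/setP => x; apply/imsetP/imsetP => -[i _ ->]; first by exists (w i).
by exists (w^-1 i)%g; rewrite //= permKV.
Qed.

Lemma vert_eq n (s t : simplex n) (w : 'S_n) :
  (forall i, vert s i = vert t (w i)) -> s = t /\ w = 1%g.
Proof.
move=> st; have E : s = t.
  by apply: val_inj; rewrite -!vert_im (eq_imset _ st) (imset_perm (vert t)).
split=> //; apply/permP => i; rewrite perm1.
by apply: (@vert_inj _ t); rewrite -st E.
Qed.

Lemma eq_bracket n (v v' : 'I_n -> V) : v =1 v' -> bracket v = bracket v'.
Proof.
move=> E; apply/ffunP => s; rewrite !ffunE; apply: eq_bigl => w.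
by apply: eq_forallb => i; rewrite E.
Qed.

Lemma bracket_perm n (v : 'I_n -> V) (w : 'S_n) :
  bracket (v \o w) = bracket v *~ (-1) ^+ w.
Proof.
apply/ffunP => s; rewrite ffunMzE !ffunE.
rewrite mulrzz [RHS]mulr_suml (reindex_inj (mulgI w)) /=.
apply: eq_big => [u|u _]; last by rewrite odd_permM signr_addb mulrC.
apply/forallP/forallP => E i.
  by have := E (w^-1 i)%g; rewrite permM permKV.
by rewrite permM; apply: E.
Qed.

Lemma bracket_vert n (s t : simplex n) : bracket (vert s) t = (s == t)%:R.
Proof.
rewrite ffunE; have [<-|st] := eqVneq s t.
  rewrite (big_pred1 1%g) ?odd_perm1 // => w; apply/forallP/eqP => [E|-> i].
    by have [] := @vert_eq _ s s w (fun i => eqP (E i)).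
  by rewrite perm1.
rewrite big_pred0 // => w; apply: contraNF st => /forallP E.
by have [-> _] := @vert_eq _ s t w (fun i => eqP (E i)).
Qed.

Lemma bracket_lin n (W : zmodType) (F : simplex n -> W) (s : simplex n) :
  \sum_t F t *~ bracket (vert s) t = F s.
Proof.
rewrite (bigD1 s) //= bracket_vert eqxx mulr1z big1 ?addr0 // => t.
by rewrite bracket_vert eq_sym => /negPf->; rewrite mulr0z.
Qed.

Lemma chainE n (c : chain n) : c = \sum_s bracket (vert s) *~ c s.
Proof.
apply/ffunP => t; rewrite sum_ffunE (bigD1 t) //= ffunMzE bracket_vert eqxx.
rewrite big1 ?addr0 ?mulrzz ?mul1r // => s.
by rewrite ffunMzE bracket_vert => /negPf->; rewrite mul0rz.
Qed.

Lemma bracketP n (v : 'I_n -> V) :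
  (exists (s : simplex n) (w : 'S_n), v =1 vert s \o w) \/
  (bracket v = 0 /\ ~ (injective v /\ v @: 'I_n \in faces D)).
Proof.
have [/andP[/injectiveP vI vD]|N] :=
  boolP (injectiveb v && (v @: 'I_n \in faces D)).
  left; have sP : (v @: 'I_n \in faces D) && (#|v @: 'I_n| == n).
    by rewrite vD card_imset // card_ord eqxx.
  pose s : simplex n := exist (fun t => (t \in faces D) && (#|t| == n)) _ sP.
  have H i : exists j, v i == vert s j.
    have: v i \in val s by apply: imset_f.
    by rewrite -vert_im => /imsetP[j _ ->]; exists j.
  pose f i := xchoose (H i); have fP i : v i = vert s (f i).
    exact/eqP/(xchooseP (H i)).
  have fI : injective f by move=> i j E; apply: vI; rewrite !fP E.
  by exists s, (perm fI) => i /=; rewrite permE.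
right; split; last first.
  by case=> /injectiveP vI vD; rewrite vI vD in N.
apply/ffunP => s; rewrite !ffunE big_pred0 // => w; apply: contraNF N.
move=> /forallP E; have {}E : v =1 vert s \o w by move=> i; apply/eqP.
apply/andP; split.
  by apply/injectiveP => i j; rewrite !E => /vert_inj /perm_inj.
by rewrite (eq_imset _ E) imset_perm vert_im simplex_faces.
Qed.

Lemma chain_act_bracket n g (v : 'I_n -> V) :
  g \in simp_aut D -> chain_act g (bracket v) = bracket (g \o v).
Proof.
move=> gD; have [[s [w E]]|[-> N]] := bracketP v.
  rewrite (eq_bracket E) bracket_perm raddfMz /=.
  rewrite [chain_act _ _]bracket_lin -bracket_perm.
  by apply: eq_bracket => i /=; rewrite E.
rewrite raddf0; have [[s [w E]]|[-> //]] := bracketP (g \o v); case: N.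
split; first by move=> i j /(congr1 g); rewrite -!/((g \o v) _) !E
  => /vert_inj /perm_inj.
by rewrite -(simp_aut_faces _ gD) -imset_comp (eq_imset _ E) imset_perm vert_im
  simplex_faces.
Qed.

Lemma chain_act1 n (c : chain n) : chain_act 1%g c = c.
Proof.
rewrite [RHS]chainE; apply: eq_bigr => s _; congr (_ *~ _).
by apply: eq_bracket => i /=; rewrite perm1.
Qed.

(* In {perm V}, (g * h) x = h (g x). *)
Lemma chain_actM n g h (c : chain n) :
  h \in simp_aut D -> chain_act (g * h)%g c = chain_act h (chain_act g c).
Proof.
move=> hD; rewrite [chain_act g c]/chain_act raddf_sum; apply: eq_bigr => s _.
rewrite raddfMz /= chain_act_bracket //; congr (_ *~ _).
by apply: eq_bracket => i /=; rewrite permM.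
Qed.

Lemma lift_permE n (w : 'S_n) (j : 'I_n) :
  exists2 u : 'S_n.-1, w \o lift j =1 lift (w j) \o u &
    (odd_perm u = odd j (+) odd (w j) (+) w).
Proof.
case: n w j => [|n] w j; first by case: j.
have H k : exists k', w (lift j k) == lift (w j) k'.
  have : w j != w (lift j k) by rewrite (inj_eq perm_inj) neq_lift.
  by case/unlift_some => k' -> _; exists k'.
pose f k := xchoose (H k).
have fP k : w (lift j k) = lift (w j) (f k) by exact/eqP/(xchooseP (H k)).
have fI : injective f.
  by move=> k l E; apply/(@lift_inj _ j)/(@perm_inj _ w); rewrite !fP E.
exists (perm fI); first by move=> k /=; rewrite permE.
have -> : w = lift_perm j (w j) (perm fI).
  apply/permP => i; case: (unliftP j i) => [k ->|->]; last by rewrite lift_perm_id.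
  by rewrite lift_perm_lift fP permE.
by rewrite odd_lift_perm lift_perm_id addKb.
Qed.

Lemma bd_bracket n (v : 'I_n -> V) : injective v -> v @: 'I_n \in faces D ->
  bd (bracket v) = \sum_(j < n) bracket (v \o lift j) *~ (-1) ^+ j.
Proof.
move=> vI vD; have [[s [w E]]|[_ []] //] := bracketP v.
rewrite (eq_bracket E) bracket_perm raddfMz /= [bd _]bracket_lin.
rewrite (reindex_inj (@perm_inj _ w)) /= mulrz_suml; apply: eq_bigr => j _.
have [u uE uo] := lift_permE w j.
have -> : bracket (v \o lift j) = bracket ((vert s \o lift (w j)) \o u).
  by apply: eq_bracket => k /=; have /= := uE k; rewrite E /= => ->.
rewrite bracket_perm -!mulrzA; congr (_ *~ _).
rewrite uo !signr_addb !signr_odd.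
rewrite [RHS]mulrC !mulrA -expr2 sqrr_sign mul1r mulrC.
by rewrite mulrC.
Qed.

Lemma chain_act_bd n g (c : chain n) :
  g \in simp_aut D -> bd (chain_act g c) = chain_act g (bd c).
Proof.
move=> gD; rewrite [chain_act g c]/chain_act [bd c]/bd !raddf_sum /=.
apply: eq_bigr => s _; rewrite !raddfMz /= raddf_sum bd_bracket /=; last first.
- rewrite (imset_comp g) vert_im simp_aut_faces //; exact: simplex_faces.
- by move=> i j /= /perm_inj /vert_inj.
congr (_ *~ _); apply: eq_bigr => j _.
by rewrite raddfMz /= chain_act_bracket.
Qed.

Lemma bd_bd n (c : chain n) : bd (bd c) = 0.
Proof.
rewrite [bd c]/bd raddf_sum /= big1 // => s _; rewrite raddfMz raddf_sum /=.
suff -> : \sum_(j < n) bd (bracket (vert s \o lift j) *~ (-1) ^+ j) = 0.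
  by rewrite mul0rz.
pose F (p : 'I_n * 'I_n.-1) :=
  bracket (vert s \o lift p.1 \o lift p.2) *~ (-1) ^+ (p.1 + p.2).
transitivity (\sum_p F p).
  rewrite -(pair_bigA _ (fun j k => F (j, k))) /=; apply: eq_bigr => j _.
  rewrite raddfMz /= bd_bracket; last first.
  - apply: (complexS (simplex_faces s)); rewrite -vert_im (imset_comp (vert s)).
    by apply: imsetS; apply/subsetP.
  - by move=> k l /= /vert_inj /lift_inj.
  rewrite mulrz_suml; apply: eq_bigr => k _.
  by rewrite -mulrzA -exprD addnC.
case: n c s @F => [|[|m]] c s F; first by rewrite big1 // => -[[]].
  by rewrite big1 // => -[j []].
pose phi (p : 'I_m.+2 * 'I_m.+1) : 'I_m.+2 * 'I_m.+1 :=
  (lift p.1 p.2, inord (unbump p.2 p.1)).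
have phi2 p : (phi p).2 = unbump p.2 p.1 :> nat.
  case: p => j k /=; rewrite inordK // /unbump.
  by case: j k => [j jP] [k kP] /=; case: ltnP => /=; lia.
have phiE p : F (phi p) = - F p.
  rewrite /F -mulrNz; congr (_ *~ _).
    apply: eq_bracket => i /=; congr (vert s _); apply: val_inj.
    by rewrite /= phi2 [RHS]bumpC.
  rewrite phi2 /= -[RHS]mulN1r -exprS /bump /unbump -signr_odd -[RHS]signr_odd.
  by congr (_ ^+ _); lia.
have phiK : involutive phi.
  move=> p; rewrite [p in RHS]surjective_pairing [LHS]surjective_pairing.
  congr (_, _); apply: val_inj; rewrite /= !phi2 /= /bump /unbump; first by lia.
  by case: p => j k /=; rewrite inordK; have := ltn_ord k; lia.
have SN : \sum_p F p = - \sum_p F p.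
  rewrite {1}(reindex_inj (inv_inj phiK)) -sumrN /=.
  by apply: eq_bigr => p _; apply: phiE.
move: SN; set S := \sum_p F p => SN; apply/ffunP => t; rewrite ffunE.
have /eqP : S t = - S t by rewrite {1}SN ffunE.
by rewrite -addr_eq0 -mulr2n Num.Theory.mulrn_eq0 => /eqP.
Qed.

Definition cycles n : {pred chain n} := [pred z | bd z == 0].

Lemma cycles_zmod_closed n : zmod_closed (@cycles n).
Proof.
split; first by rewrite inE raddf0.
by move=> y z /eqP yc /eqP zc; apply/eqP; rewrite raddfB /= yc zc subr0.
Qed.
HB.instance Definition _ n :=
  GRing.isZmodClosed.Build (chain n) (@cycles n) (@cycles_zmod_closed n).

Definition cycle n := {z : chain n | z \in @cycles n}.
HB.instance Definition _ n := SubChoice.on (cycle n).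
HB.instance Definition _ n := [SubChoice_isSubZmodule of cycle n by <:].

Definition boundaries n : {pred cycle n} :=
  fun z => `[< exists c : chain n.+1, bd c = val z >].

Lemma boundaries_zmod_closed n : zmod_closed (@boundaries n).
Proof.
split; first by apply/asboolP; exists 0; rewrite raddf0 raddf0.
move=> y z /asboolP[c cy] /asboolP[d dz]; apply/asboolP; exists (c - d).
by have /= -> := raddfB (@bd n.+1) c d; rewrite cy dz -[RHS]/(val (y - z)) [RHS](raddfB (val : cycle n -> chain n)).
Qed.
HB.instance Definition _ n :=
  GRing.isZmodClosed.Build (cycle n) (@boundaries n) (@boundaries_zmod_closed n).

(* The reduced homology group of degree n - 1. *)
Definition homology n := Quotient.quot (@boundaries n).
HB.instance Definition _ n := ZmodQuotient.on (homology n).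

Lemma chain_act_cycles n g (gD : g \in simp_aut D) (z : cycle n) :
  chain_act g (val z) \in @cycles n.
Proof.
by rewrite inE chain_act_bd //; have /eqP-> := valP z; rewrite raddf0.
Qed.

Definition cycle_act n g (gD : g \in simp_aut D) (z : cycle n) : cycle n :=
  Sub (chain_act g (val z)) (chain_act_cycles gD z).

Definition homology_act n g (gD : g \in simp_aut D) (x : homology n) :
  homology n := \pi_(homology n) (cycle_act gD (repr x)).

Lemma homology_act_pi n g (gD : g \in simp_aut D) (z : cycle n) :
  homology_act gD (\pi_(homology n) z) = \pi_(homology n) (cycle_act gD z).
Proof.
apply/eqP; rewrite /homology_act -Quotient.idealrBE.
have : repr (\pi_(homology n) z) - z \in @boundaries n.
  by rewrite Quotient.idealrBE reprK.
move=> /asboolP[c cE]; apply/asboolP; exists (chain_act g c).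
by rewrite chain_act_bd // cE !raddfB.
Qed.

End Chains.

Record matroid (E : finType) := Matroid {
  indep : {set {set E}};
  indep0 : set0 \in indep;
  indepS : forall I J : {set E}, I \in indep -> J \subset I -> J \in indep;
  indep_aug : forall I J : {set E}, I \in indep -> J \in indep ->
    (#|I| < #|J|)%N -> exists2 x, x \in J :\: I & x |: I \in indep
}.

Section Matroids.
Variables (E : finType) (M : matroid E).

Definition rank (A : {set E}) : nat :=
  \max_(I in indep M | I \subset A) #|I|.

Definition flat (A : {set E}) : bool :=
  [forall (x | x \notin A), (rank A < rank (x |: A))%N].

Definition matroid_aut : {set {perm E}} :=
  [set g : {perm E} | [forall I : {set E} in indep M, g @: I \in indep M]].

Definition indep_complex : complex E := Complex (indep0 M) (@indepS E M).

Lemma indep_simp_aut g : g \in matroid_aut -> g \in simp_aut indep_complex.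
Proof. by []. Qed.

(* The vertex y_i is [inl i] and the vertex x_F is [inr F]; an [inr A] with A
   not a proper flat lies in no simplex. *)
Definition ypart (s : {set E + {set E}}) : {set E} := [set i | inl i \in s].
Definition xpart (s : {set E + {set E}}) : {set {set E}} :=
  [set F | inr F \in s].

Definition bergman_faces : {set {set E + {set E}}} :=
  [set s | [&& ypart s \in indep M,
    [forall F in xpart s, [&& flat F, F != setT & ypart s \subset F]] &
    [forall F in xpart s, forall G in xpart s,
       (F \subset G) || (G \subset F)]]].

Lemma bergman_facesP (s : {set E + {set E}}) :
  reflect (exists (I : {set E}) (Fs : seq {set E}),
    [/\ I \in indep M,
        {in Fs, forall F, flat F /\ F != setT},
        {in Fs, forall F : {set E}, I \subset F},
        sorted (fun F G : {set E} => F \proper G) Fs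
      & s = inl @: I :|: inr @: [set:: Fs]])
  (s \in bergman_faces).
Proof.
rewrite inE; apply: (iffP and3P) => [[yI /forall_inP xF xC]|].
  pose le (F G : {set E}) := F \subset G.
  exists (ypart s), (sort le (enum (xpart s))); split=> //.
  - by move=> F; rewrite mem_sort mem_enum => /xF /and3P[].
  - by move=> F; rewrite mem_sort mem_enum => /xF /and3P[].
  - have leT : {in xpart s &, total le}.
      by move=> F G FS GS; have /forall_inP/(_ F FS)/forall_inP/(_ G GS) := xC.
    have : sorted le (sort le (enum (xpart s))).
      apply: (sort_sorted_in leT); apply/allP => F.
      by rewrite mem_enum.
    have : uniq (sort le (enum (xpart s))) by rewrite sort_uniq enum_uniq.
    elim: (sort _ _) => //= F [//|G t] IH /= /andP[Ft Ut] /andP[FG Gt].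
    apply/andP; split; last exact: IH.
    rewrite properEneq [_ \subset _]FG andbT.
    by apply: contraNneq Ft => ->; rewrite inE eqxx.
  - apply/setP => -[i|F]; rewrite !inE.
      rewrite mem_imset ?inE; last by move=> ? ? [].
      by rewrite orbC; case: imsetP => // -[].
    rewrite [in RHS]orbC mem_imset ?inE; last by move=> ? ? [].
    rewrite mem_sort mem_enum inE; case: imsetP; rewrite ?orbF //.
    by case.
move=> [I [Fs [Iin Fsf IFs Fsort ->]]].
have -> : ypart (inl @: I :|: inr @: [set:: Fs]) = I.
  apply/setP => i; rewrite !inE mem_imset; last by move=> ? ? [].
  by rewrite orbC; case: imsetP => // -[].
have xE F : (F \in xpart (inl @: I :|: inr @: [set:: Fs])) = (F \in Fs).
  rewrite !inE orbC mem_imset ?inE; last by move=> ? ? [].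
  by case: imsetP; rewrite ?orbF // => -[].
split=> //.
  by apply/forall_inP => F; rewrite xE => FF; have [-> ->] := Fsf F FF; exact: IFs.
apply/forall_inP => F; rewrite xE => FF; apply/forall_inP => G; rewrite xE => GF.
have [->|FG] := eqVneq F G; first by rewrite subxx.
have tr : transitive (fun F G : {set E} => F \proper G).
  by move=> A B C; apply: proper_trans.
move: Fsort FF GF; rewrite (sorted_pairwise tr).
elim: Fs {Fsf IFs xE} => //= A t IH /andP[/allP At pt].
rewrite !inE => /predU1P[-> |Ft] /predU1P[GA|Gt]; last exact: IH.
- by rewrite GA subxx.
- by rewrite (proper_sub (At _ Gt)).
- by rewrite GA (proper_sub (At _ Ft)) orbT.
Qed.

Lemma bergman0 : set0 \in bergman_faces.
Proof.
apply/bergman_facesP; exists set0, [::]; split=> //; first exact: indep0.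
by apply/setP => x; rewrite !inE; apply/esym/norP; split; apply/imsetP => -[y];
  rewrite inE.
Qed.

Lemma bergmanS (s t : {set E + {set E}}) :
  s \in bergman_faces -> t \subset s -> t \in bergman_faces.
Proof.
rewrite !inE => /and3P[yI /forall_inP xF /forall_inP xC] /subsetP ts.
have yts : ypart t \subset ypart s by apply/subsetP => i; rewrite !inE => /ts.
have xts F : F \in xpart t -> F \in xpart s by rewrite !inE => /ts.
apply/and3P; split; first exact: indepS yI yts.
  apply/forall_inP => F /xts /xF /and3P[-> -> /=]; exact: subset_trans.
apply/forall_inP => F /xts /xC /forall_inP xCF.
by apply/forall_inP => G /xts /xCF.
Qed.

Definition bergman : complex (E + {set E})%type := Complex bergman0 bergmanS.

Definition bergman_fun (g : {perm E}) (v : E + {set E}) : E + {set E} :=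
  match v with inl i => inl (g i) | inr F => inr (g @: F) end.

Lemma bergman_fun_inj g : injective (bergman_fun g).
Proof.
move=> [i|F] [j|G] //= [] => [/perm_inj->//|/imset_inj -> //].
exact: perm_inj.
Qed.

Definition bergman_perm (g : {perm E}) : {perm (E + {set E})%type} :=
  perm (@bergman_fun_inj g).

Lemma rank_le_aut g (A : {set E}) :
  g \in matroid_aut -> (rank A <= rank (g @: A))%N.
Proof.
move=> gM; apply/bigmax_leqP => I /andP[II IA].
rewrite -(card_imset _ (@perm_inj _ g)).
apply: (@leq_bigmax_cond _ _ (fun I : {set E} => #|I|)).
by rewrite imsetS // andbT; exact: (simp_autP indep_complex g gM).
Qed.

Lemma imset_permK (g : {perm E}) (A : {set E}) : g^-1%g @: (g @: A) = A.
Proof.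
rewrite -imset_comp -[RHS]imset_id; apply: eq_imset => x /=; exact: permK.
Qed.

Lemma rank_aut g (A : {set E}) : g \in matroid_aut -> rank (g @: A) = rank A.
Proof.
move=> gM; apply/eqP; rewrite eqn_leq rank_le_aut // andbT.
rewrite -{2}(imset_permK g A); apply: rank_le_aut.
exact: (groupVr (G := simp_aut_group indep_complex) gM).
Qed.

Lemma flat_aut g (A : {set E}) : g \in matroid_aut -> flat A -> flat (g @: A).
Proof.
move=> gM /forall_inP fA; apply/forall_inP => x xA.
have gx : g (g^-1%g x) = x by rewrite permKV.
rewrite -gx -imsetU1 !rank_aut //; apply: fA.
by apply: contraNN xA => /(imset_f g); rewrite gx.
Qed.

Lemma bergman_simp_aut g :
  g \in matroid_aut -> bergman_perm g \in simp_aut bergman.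
Proof.
move=> gM; apply/simp_autP => s; rewrite !inE.
have yE : ypart (bergman_perm g @: s) = g @: ypart s.
  apply/setP => i; rewrite inE; apply/imsetP/imsetP.
    by case=> -[j|F] js; rewrite permE //= => -[->]; exists j; rewrite ?inE.
  by case=> j; rewrite inE => js ->; exists (inl j); rewrite ?permE.
have xE : xpart (bergman_perm g @: s) = [set g @: (F : {set E}) | F in xpart s].
  apply/setP => F; rewrite inE; apply/imsetP/imsetP.
    by case=> -[j|G] js; rewrite permE //= => -[->]; exists G; rewrite ?inE.
  by case=> G; rewrite inE => Gs ->; exists (inr G); rewrite ?permE.
rewrite yE xE => /and3P[yI /forall_inP xF /forall_inP xC]; apply/and3P; split.
- exact: (simp_autP indep_complex g gM).
- apply/forall_inP => _ /imsetP[F /xF /and3P[fF FT yF] ->].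
  rewrite flat_aut // imsetS // andbT /=; apply: contraNneq FT => gF.
  have := card_imset (mem F) (@perm_inj _ g); rewrite gF => cE.
  by rewrite eqEcard subsetT cE leqnn.
- apply/forall_inP => _ /imsetP[F Fs ->]; apply/forall_inP => _ /imsetP[G Gs ->].
  by have /forall_inP/(_ G Gs)/orP[] := xC F Fs => FG; rewrite (imsetS _ FG) ?orbT.
Qed.

End Matroids.

(* Main.v *)
(* No simplex of the augmented Bergman complex has more than r(M) vertices, so
   its top homology is its group of top cycles, and the isomorphism restricts a
   cycle to the simplices {y_i : i in B}, B a basis.  Bijectivity amounts to the
   acyclicity of the subcomplex of simplices (I, F_1 < ... < F_l) with I not a
   basis.  There the closure of I is a proper flat contained in F_1, so that
   s |-> [x_{cl I}, s] is a contracting homotopy up to terms in which I has lost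
   an element; induct on |I|. *)
From HB Require Import structures.
Require Import Defs.
From mathcomp Require Import all_boot all_order all_algebra all_fingroup.
From mathcomp Require Import boolp.
From mathcomp Require Import generic_quotient ring_quotient.
Set Implicit Arguments.
Unset Strict Implicit.
Unset Printing Implicit Defensive.

Import GRing.Theory.
Local Open Scope ring_scope.

(** * Cones over oriented simplices and their boundaries *)

Section Cones.
Variables (V : finType) (D : complex V).

Definition fcons n (x : V) (v : 'I_n -> V) (i : 'I_n.+1) : V :=
  oapp v x (unlift ord0 i).

Lemma fcons0 n x (v : 'I_n -> V) : fcons x v ord0 = x.
Proof. by rewrite /fcons unlift_none. Qed.

Lemma fcons_lift n x (v : 'I_n -> V) i : fcons x v (lift ord0 i) = v i.
Proof. by rewrite /fcons liftK. Qed.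

Lemma fcons_im n x (v : 'I_n -> V) :
  fcons x v @: 'I_n.+1 = x |: v @: 'I_n.
Proof.
apply/setP => y; rewrite !inE; apply/imsetP/orP.
  case=> i _ ->; case: (unliftP ord0 i) => [j ->|->].
    by rewrite fcons_lift; right; exact: imset_f.
  by rewrite fcons0; left.
case=> [/eqP->|/imsetP[j _ ->]]; first by exists ord0; rewrite ?fcons0.
by exists (lift ord0 j); rewrite ?fcons_lift.
Qed.

Lemma fcons_inj n x (v : 'I_n -> V) :
  injective (fcons x v) <-> injective v /\ x \notin v @: 'I_n.
Proof.
split=> [I|[I xv]].
  split; first by move=> i j E; apply/(@lift_inj _ ord0)/I; rewrite !fcons_lift.
  apply/imsetP => -[i _ xi]; have /I : fcons x v ord0 = fcons x v (lift ord0 i).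
    by rewrite fcons0 fcons_lift.
  by move=> E; have := neq_lift ord0 i; rewrite -E eqxx.
move=> i j; case: (unliftP ord0 i) => [k ->|->]; case: (unliftP ord0 j) => [l ->|->] //;
  rewrite ?fcons0 ?fcons_lift.
- by move/I->.
- by move=> E; rewrite -E imset_f in xv.
- by move=> E; rewrite E imset_f in xv.
Qed.

Lemma raddf_chain n (W : zmodType) (f : {additive chain D n -> W}) c :
  f c = \sum_(s : simplex D n) f (bracket D (vert s)) *~ c s.
Proof.
rewrite {1}[c]chainE raddf_sum; apply: eq_bigr => s _; exact: raddfMz.
Qed.

Lemma bracket_eq0 n (v : 'I_n -> V) :
  ~ (injective v /\ v @: 'I_n \in faces D) -> bracket D v = 0.
Proof.
have [[s [w E]]|[] //] := bracketP D v; case; split.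
  by move=> i j; rewrite !E /= => /vert_inj /perm_inj.
by rewrite (eq_imset _ E) imset_perm vert_im simplex_faces.
Qed.

Lemma bracket_notin n (v : 'I_n -> V) (s : simplex D n) :
  v @: 'I_n != val s -> bracket D v s = 0.
Proof.
move=> N; rewrite ffunE big_pred0 // => w; apply: contraNF N => /forallP E.
have {}E : v =1 vert s \o w by move=> i; apply/eqP.
by rewrite (eq_imset _ E) imset_perm vert_im.
Qed.

Lemma fcons_bracket0 n x (v : 'I_n -> V) :
  x \in v @: 'I_n -> bracket D (fcons x v) = 0.
Proof.
by move=> xv; apply: bracket_eq0 => -[/fcons_inj[_]]; rewrite xv.
Qed.

(** [lift_perm ord0 ord0 w] fixes the new first position, permutes the others by w, and has the
    parity of w. *)
Lemma fcons_perm n x (v : 'I_n -> V) (w : 'S_n) :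
  bracket D (fcons x (v \o w)) = bracket D (fcons x v) *~ (-1) ^+ w.
Proof.
rewrite -[odd_perm w](odd_lift_perm ord0 ord0 w) -bracket_perm.
apply: eq_bracket => i /=; case: (unliftP ord0 i) => [j ->|->].
  by rewrite lift_perm_lift !fcons_lift.
by rewrite lift_perm_id !fcons0.
Qed.

Lemma eq_fcons n x (v v' : 'I_n -> V) : v =1 v' -> fcons x v =1 fcons x v'.
Proof. by move=> E i; rewrite /fcons; case: unlift => //=. Qed.

(** The cycle that brings position j to the front and keeps the order of the others is a product of
    j transpositions. *)
Lemma bracket_rot n (v : 'I_n.+1 -> V) j :
  bracket D v = bracket D (fcons (v j) (v \o lift j)) *~ (-1) ^+ j.
Proof.
have := odd_lift_perm j ord0 (1%g : 'S_n).
rewrite odd_perm1 !addbF => E; rewrite -signr_odd -E -bracket_perm.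
apply: eq_bracket => i /=; case: (unliftP j i) => [k ->|->].
  by rewrite lift_perm_lift perm1 fcons_lift.
by rewrite lift_perm_id fcons0.
Qed.

(* When x is a vertex v j, the left-hand side is 0 and so are all the terms of
   the sum but the j-th, which is the bracket of v. *)
Lemma bd_fcons n x (v : 'I_n.+1 -> V) :
  injective v -> x |: v @: 'I_n.+1 \in faces D ->
  bd (bracket D (fcons x v)) =
  bracket D v - \sum_(j < n.+1) bracket D (fcons x (v \o lift j)) *~ (-1) ^+ j.
Proof.
move=> vI xvD; have [/imsetP[j _ ->]|xv] := boolP (x \in v @: 'I_n.+1).
  rewrite fcons_bracket0 ?imset_f // raddf0 (bigD1 j) //= -bracket_rot.
  rewrite big1 ?addr0 ?subrr // => i ij; rewrite fcons_bracket0 ?mul0rz //.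
  have [k -> _] := unlift_some ij.
  by apply/imsetP; exists k.
rewrite bd_bracket ?fcons_im //; last exact/fcons_inj.
(* Omitting the apex gives back v; omitting vertex i of v omits position i + 1 of the cone, whence
   the minus sign. *)
rewrite big_ord_recl /=; congr (_ + _).
  by apply: eq_bracket => i /=; rewrite fcons_lift.
rewrite -sumrN; apply: eq_bigr => i _; rewrite /bump /= exprS mulN1r mulrNz.
congr (- (_ *~ _)); apply: eq_bracket => k /=.
case: (unliftP ord0 k) => [l ->|->].
  have -> : lift (lift ord0 i) (lift ord0 l) = lift ord0 (lift i l).
    by apply: val_inj; rewrite /= /bump /= ltnS; case: leqP; rewrite ?addnS.
  by rewrite !fcons_lift.
have -> : lift (lift ord0 i) ord0 = ord0 :> 'I_n.+2 by apply: val_inj.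
by rewrite !fcons0.
Qed.

(** The cone over the empty simplex, where there are no faces of v to cone over. *)
Lemma bd_fcons0 x (v : 'I_0 -> V) :
  [set x] \in faces D -> bd (bracket D (fcons x v)) = bracket D v.
Proof.
move=> xD; have v0 : v @: 'I_0 = set0.
  by apply/setP => y; rewrite inE; apply/imsetP => -[[]].
rewrite bd_bracket ?fcons_im ?v0 ?setU0 //; last first.
  by apply/fcons_inj; split=> [[]|]; rewrite ?v0 ?inE.
rewrite big_ord1 expr0 mulr1z; apply: eq_bracket => -[] //.
Qed.

End Cones.

(** * Independent sets, closures and flats *)

Section Closure.
Variables (E : finType) (M : matroid E).
Implicit Types (I J A F G : {set E}) (x : E).

Lemma rank_leP A m :
  reflect (forall I, I \in indep M -> I \subset A -> (#|I| <= m)%N)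
    (rank M A <= m)%N.
Proof.
apply: (iffP (bigmax_leqP _ _ _)) => H I; last by case/andP; exact: H.
by move=> II IA; apply: H; rewrite II.
Qed.

Lemma indep_rank I A : I \in indep M -> I \subset A -> (#|I| <= rank M A)%N.
Proof. by move=> II IA; exact: (rank_leP A _ (leqnn _)). Qed.

Lemma rankS A F : A \subset F -> (rank M A <= rank M F)%N.
Proof.
move=> AF; apply/rank_leP => I II IA; apply: indep_rank => //.
exact: subset_trans AF.
Qed.

(** Take J maximal among the independent sets between I and A: a larger independent subset of A
    would augment it inside A. *)
Lemma indep_extend I A : I \in indep M -> I \subset A ->
  exists J, [/\ J \in indep M, I \subset J, J \subset A & #|J| = rank M A].
Proof.
move=> II IA.
have [J /maxsetP[/and3P[JI IJ JA] Jm] _] :=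
  maxset_exists (P := fun J => [&& J \in indep M, I \subset J & J \subset A])
    (introT and3P (And3 II (subxx I) IA)).
exists J; split=> //; apply/eqP; rewrite eqn_leq indep_rank //=.
apply/rank_leP => K KI KA; rewrite leqNgt; apply/negP => lt.
have [x] := indep_aug JI KI lt; rewrite inE => /andP[xJ xK] xJI.
have xE : x |: J = J.
  apply: Jm; last exact: subsetUr.
  rewrite xJI (subset_trans IJ) ?subsetUr //=.
  by rewrite subUset JA andbT sub1set (subsetP KA).
by rewrite -xE setU11 in xJ.
Qed.

(** For independent I this is the matroid closure, the smallest flat containing I, expressed by
    independence instead of rank. *)
Definition closure I := [set x | (x \in I) || (x |: I \notin indep M)].

Lemma sub_closure I : I \subset closure I.
Proof. by apply/subsetP => x; rewrite inE => ->. Qed.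

(** Let J extend I to a basis of F and let x lie outside F. The rank of [x |: F] is larger, so J can
    be augmented there, and only by x since J already has the rank of F; hence [x |: I] is
    independent and x is not in the closure. *)
Lemma closure_min I F :
  I \in indep M -> flat M F -> I \subset F -> closure I \subset F.
Proof.
move=> II /forall_inP fF IF; apply/subsetP => x; apply: contraLR => xF.
rewrite inE negb_or negbK (contraNN (subsetP IF x)) //=.
have [J [JI IJ JF Jr]] := indep_extend II IF.
have [K [KI _ KF Kr]] := indep_extend (indep0 M) (sub0set (x |: F)).
have [y] : exists2 y, y \in K :\: J & y |: J \in indep M.
  by apply: indep_aug; rewrite // Jr Kr fF.
rewrite inE => /andP[yJ yK] yJI; have := subsetP KF y yK.
case/setU1P => [yx|yF].
  by apply: indepS yJI _; rewrite yx setUS.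
have : (#|y |: J| <= rank M F)%N.
  by apply: indep_rank; rewrite // subUset sub1set yF.
by rewrite cardsU1 yJ Jr ltnn.
Qed.

(** A larger independent set inside the closure would augment I by an element that the definition of
    [closure] excludes. *)
Lemma rank_closure I : I \in indep M -> rank M (closure I) = #|I|.
Proof.
move=> II; apply/eqP; rewrite eqn_leq (indep_rank II (sub_closure I)) andbT.
apply/rank_leP => J JI /subsetP JC; rewrite leqNgt; apply/negP => lt.
have [x] := indep_aug II JI lt; rewrite inE => /andP[xI /JC] + xII.
by rewrite inE (negPf xI) xII.
Qed.

Lemma flat_closure I : I \in indep M -> flat M (closure I).
Proof.
move=> II; apply/forall_inP => x; rewrite inE negb_or negbK => /andP[xI xII].
rewrite rank_closure //; apply: leq_trans (indep_rank xII (setUS _ (sub_closure I))).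
by rewrite cardsU1 xI.
Qed.

Lemma closure_proper I :
  I \in indep M -> (#|I| < rank M [set: E])%N -> closure I != setT.
Proof. by move=> II; apply: contraTneq => <-; rewrite rank_closure // ltnn. Qed.

Lemma flat_rank_lt F G : flat M F -> F \proper G -> (rank M F < rank M G)%N.
Proof.
move=> /forall_inP fF /properP[FG [x xG xF]].
by apply: leq_trans (fF x xF) (rankS _); rewrite subUset sub1set xG.
Qed.

Lemma bergman_card s : s \in faces (bergman M) -> (#|s| <= rank M [set: E])%N.
Proof.
rewrite inE => /and3P[yI /forall_inP xF /forall_inP xC].
have -> : #|s| = (#|ypart s| + #|xpart s|)%N.
  rewrite -(card_imset (ypart s) (@inl_inj E {set E})).
  rewrite -(card_imset (xpart s) (@inr_inj E {set E})).
  rewrite -cardsUI (_ : _ :&: _ = set0) ?cards0 ?addn0; last first.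
    apply/setP => y; rewrite !inE; apply/andP => -[/imsetP[i _ ->]].
    by case/imsetP.
  congr #|pred_of_set _|; apply/setP => -[i|F]; rewrite !inE.
    rewrite mem_imset ?inE; last exact: inl_inj.
    by case: imsetP; rewrite ?orbF // => -[].
  rewrite orbC mem_imset ?inE; last exact: inr_inj.
  by case: imsetP; rewrite ?orbF // => -[].
rewrite [#|xpart s|]cardE -(size_map (rank M)).
(* Rank is injective on the chain of flats, with values in [|I|, r(M)). *)
have U : uniq [seq rank M F | F <- enum (xpart s)].
  rewrite map_inj_in_uniq ?enum_uniq // => F G; rewrite !mem_enum => FS GS E1.
  apply/eqP/negPn/negP => FG; have /and3P[fF _ _] := xF F FS.
  have /and3P[fG _ _] := xF G GS.
  have /forall_inP/(_ G GS)/orP[sub|sub] := xC F FS.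
    have := flat_rank_lt (G := G) fF; rewrite properEneq FG sub E1 ltnn.
    by move/(_ isT).
  have := flat_rank_lt (G := F) fG; rewrite properEneq eq_sym FG sub E1 ltnn.
  by move/(_ isT).
have yr : (#|ypart s| <= rank M [set: E])%N by exact: indep_rank.
rewrite -leq_subRL // -(size_iota #|ypart s| (rank M setT - _)).
apply: uniq_leq_size => // _ /mapP[F + ->]; rewrite mem_enum => FS.
have /and3P[fF FT yF] := xF F FS.
rewrite mem_iota subnKC // indep_rank //=; apply: flat_rank_lt => //.
by rewrite properEneq FT subsetT.
Qed.

(** The closure of the y-part lies in every flat of s, so it can be put at the bottom of the chain;
    it is a proper flat because the y-part is not a basis. *)
Lemma bergman_closure (s : {set E + {set E}}) :
  s \in faces (bergman M) -> (#|ypart s| < rank M [set: E])%N ->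
  inr (closure (ypart s)) |: s \in faces (bergman M).
Proof.
rewrite [_ \in faces _]inE => /and3P[yI /forall_inP xF /forall_inP xC] lt.
rewrite inE; have -> : ypart (inr (closure (ypart s)) |: s) = ypart s.
  by apply/setP => i; rewrite !inE.
have xE F : F \in xpart (inr (closure (ypart s)) |: s) ->
    F = closure (ypart s) \/ F \in xpart s.
  by rewrite !inE => /predU1P[[->]|]; [left | right].
have cmin F : F \in xpart s -> closure (ypart s) \subset F.
  by move=> /xF /and3P[fF _ yF]; exact: closure_min.
rewrite yI /=; apply/andP; split; apply/forall_inP => F /xE[->|FS].
- by rewrite flat_closure // closure_proper // sub_closure.
- exact: xF.
- by apply/forall_inP => G /xE[->|/cmin->] //; rewrite subxx.
- apply/forall_inP => G /xE[->|]; first by rewrite cmin ?orbT.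
  by have /forall_inP := xC F FS; exact.
Qed.

End Closure.

(** * Acyclicity of the subcomplex of simplices whose y-part is not a basis *)

Section Acyclicity.
Variables (E : finType) (M : matroid E).
Local Notation D := (bergman M).
Local Notation vertex := (E + {set E})%type.

(** The filtration by the size of the y-part. For m = 0 only the zero chain is left; for m = r(M)
    these are the chains on simplices whose y-part is not a basis. *)
Definition ybelow m n (c : chain D n) : Prop :=
  forall s : simplex D n, (m <= #|ypart (val s)|)%N -> c s = 0.

Lemma ybelow0 m n : ybelow m (0 : chain D n).
Proof. by move=> s _; rewrite ffunE. Qed.

Lemma ybelowD m n (c d : chain D n) :
  ybelow m c -> ybelow m d -> ybelow m (c + d).
Proof. by move=> C C' s ms; rewrite ffunE C // C' // addr0. Qed.

Lemma ybelowMz m n (c : chain D n) k : ybelow m c -> ybelow m (c *~ k).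
Proof. by move=> C s ms; rewrite ffunMzE C // mul0rz. Qed.

Lemma ybelowB m n (c d : chain D n) :
  ybelow m c -> ybelow m d -> ybelow m (c - d).
Proof. by move=> C C' s ms; rewrite !ffunE C // C' // subr0. Qed.

Lemma ybelow_sum m n (I : finType) (F : I -> chain D n) :
  (forall i, ybelow m (F i)) -> ybelow m (\sum_i F i).
Proof.
move=> H; elim/big_ind: _ => //; [exact: ybelow0 | exact: ybelowD].
Qed.

Lemma ybelow_bracket m n (v : 'I_n -> vertex) :
  (#|ypart (v @: 'I_n)| < m)%N -> ybelow m (bracket D v).
Proof.
move=> lt s ms; apply: bracket_notin; apply: contraTneq ms => <-.
by rewrite -ltnNge.
Qed.

(* If ypart s is a basis, then its closure is E and [apex s] lies in no face, so
   that [cone] vanishes on s. *)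
Definition apex (s : {set vertex}) : vertex := inr (closure M (ypart s)).

Definition cone n (c : chain D n) : chain D n.+1 :=
  \sum_(s : simplex D n) bracket D (fcons (apex (val s)) (vert s)) *~ c s.

Lemma cone_is_zmod_morphism n : zmod_morphism (@cone n).
Proof.
move=> c d; rewrite /cone -sumrB; apply: eq_bigr => s _.
by rewrite !ffunE mulrzBr.
Qed.
HB.instance Definition _ n :=
  GRing.isZmodMorphism.Build (chain D n) (chain D n.+1) (@cone n)
    (@cone_is_zmod_morphism n).

(** The apex depends on the vertex set only, so the defining formula passes to every ordering with
    the sign of [fcons_perm]; if v does not give a simplex, neither does its cone. *)
Lemma cone_bracket n (v : 'I_n -> vertex) :
  cone (bracket D v) = bracket D (fcons (apex (v @: 'I_n)) v).
Proof.
have [[s [w Ev]]|[-> N]] := bracketP D v.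
  rewrite (eq_bracket D Ev) bracket_perm raddfMz /=.
  rewrite [cone _]bracket_lin -fcons_perm.
  rewrite (eq_imset _ Ev) imset_perm vert_im.
  by apply: eq_bracket; apply: eq_fcons => i; rewrite Ev.
rewrite raddf0 bracket_eq0 // fcons_im => -[/fcons_inj[vI _] vD]; case: N.
by split=> //; apply: complexS vD _; exact: subsetUr.
Qed.

Lemma ypartU_inr F (s : {set vertex}) : ypart (inr F |: s) = ypart s.
Proof. by apply/setP => i; rewrite !inE. Qed.

Lemma ypartU_inl i (s : {set vertex}) : ypart (inl i |: s) = i |: ypart s.
Proof. by apply/setP => j; rewrite !inE. Qed.

Lemma ybelow_cone m n (c : chain D n) : ybelow m c -> ybelow m (cone c).
Proof.
move=> C; apply: ybelow_sum => s; have [lt|/C->] := ltnP #|ypart (val s)| m.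
  apply: ybelowMz; apply: ybelow_bracket.
  by rewrite fcons_im ypartU_inr vert_im.
by rewrite mulr0z; exact: ybelow0.
Qed.

Lemma imset_lift n (v : 'I_n.+1 -> vertex) j :
  v @: 'I_n.+1 = v j |: (v \o lift j) @: 'I_n.
Proof.
apply/setP => x; rewrite !inE; apply/imsetP/orP.
  case=> i _ ->; case: (unliftP j i) => [k ->|->]; [right|by left].
  by apply/imsetP; exists k.
by case=> [/eqP->|/imsetP[k _ ->]]; [exists j|exists (lift j k)].
Qed.

(** With s_j for s without its j-th vertex, the difference is the signed sum over j of [apex s, s_j]
    - [apex s_j, s_j]. *)
Lemma cone_homotopy m n (s : simplex D n.+1) :
  (#|ypart (val s)| <= m)%N -> (m < rank M [set: E])%N ->
  ybelow m (bracket D (vert s) - bd (cone (bracket D (vert s)))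
            - cone (bd (bracket D (vert s)))).
Proof.
move=> sm mr; have sr := leq_ltn_trans sm mr.
have vsI := @vert_inj _ _ _ s.
rewrite cone_bracket bd_fcons ?vert_im //; last first.
  exact: bergman_closure (simplex_faces s) sr.
rewrite bd_bracket ?vert_im ?simplex_faces //.
rewrite opprB addrCA subrr addr0 [cone _]raddf_sum -sumrB.
apply: ybelow_sum => j; rewrite raddfMz /= -mulrzBl; apply: ybelowMz.
rewrite cone_bracket; have := imset_lift (vert s) j; rewrite vert_im.
have : vert s j \notin (vert s \o lift j) @: 'I_n.
  apply/imsetP => -[k _ /= /vsI E1].
  by have := neq_lift j k; rewrite -E1 eqxx.
(* Deleting some x_F changes neither the y-part nor the apex, so the two cones cancel. *)
case: (vert s j) => [i|F] iN sE; last first.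
  by rewrite sE /apex ypartU_inr subrr; exact: ybelow0.
(* Deleting y_i shrinks the y-part, and neither apex adds to it, so both terms lie below m. *)
have lt : (#|ypart ((vert s \o lift j) @: 'I_n)| < m)%N.
  apply: leq_trans sm; rewrite [in X in (_ <= X)%N]sE ypartU_inl cardsU1.
  by rewrite inE iN.
by apply: ybelowB; apply: ybelow_bracket; rewrite fcons_im ypartU_inr.
Qed.

(** Over the empty simplex the apex is the closure of the empty set, and the term [cone (bd _)] is
    absent because [bd] vanishes on [chain 0]. *)
Lemma cone_homotopy0 (s : simplex D 0) :
  (0 < rank M [set: E])%N ->
  bd (cone (bracket D (vert s))) = bracket D (vert s).
Proof.
move=> r0; rewrite cone_bracket bd_fcons0 //.
have s0 : val s = set0 by apply/eqP; rewrite -cards_eq0 simplex_card.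
have y0 : ypart (set0 : {set vertex}) = set0 by apply/setP => i; rewrite !inE.
have := bergman_closure (simplex_faces s).
by rewrite vert_im s0 setU0; apply; rewrite y0 cards0.
Qed.

(** On a cycle the term [cone (bd z)] is 0, so [cone_homotopy] applies simplex by simplex; simplices
    with more than m y-vertices have coefficient 0 in z. *)
Lemma cone_reduce m n (z : chain D n) :
  (m < rank M [set: E])%N -> ybelow m.+1 z -> bd z = 0 ->
  ybelow m (z - bd (cone z)).
Proof.
case: n z => [|n] z mr zm zc.
  have -> : bd (cone z) = z; last by rewrite subrr; exact: ybelow0.
  rewrite (raddf_chain (@cone 0)) raddf_sum [RHS]chainE; apply: eq_bigr => s _.
  by rewrite raddfMz /= cone_homotopy0 // (leq_trans _ mr).
have -> : z - bd (cone z) = \sum_s (bracket D (vert s)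
    - bd (cone (bracket D (vert s))) - cone (bd (bracket D (vert s)))) *~ z s.
  have czE : bd (cone z) = \sum_s bd (cone (bracket D (vert s))) *~ z s.
    rewrite (raddf_chain (@cone n.+1)) raddf_sum; apply: eq_bigr => s _.
    by rewrite raddfMz.
  have : cone (bd z) = 0 by rewrite zc raddf0.
  have -> : cone (bd z) = \sum_s cone (bd (bracket D (vert s))) *~ z s.
    rewrite (raddf_chain (@bd _ D n.+1)) raddf_sum; apply: eq_bigr => s _.
    by rewrite raddfMz.
  move=> c0; under eq_bigr do rewrite !mulrzBl.
  by rewrite !sumrB c0 subr0 -czE -chainE.
apply: ybelow_sum => s; have [/zm->|lt] := ltnP m #|ypart (val s)|.
  by rewrite mulr0z; exact: ybelow0.
by apply: ybelowMz; exact: cone_homotopy.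
Qed.

(** Induction on m: [cone_reduce] lowers z in the filtration, modulo a boundary, until it is 0. The
    bound on d makes d invisible to [yrestrict] later. *)
Lemma ybelow_acyclic m n (z : chain D n) :
  (m <= rank M [set: E])%N -> ybelow m z -> bd z = 0 ->
  exists2 d : chain D n.+1, ybelow m d & bd d = z.
Proof.
elim: m z => [|m IH] z mr zm zc.
  exists 0; first exact: ybelow0.
  by rewrite raddf0; apply/ffunP => s; rewrite zm ?ffunE.
have zm' := cone_reduce mr zm zc.
have [|d dm dE] := IH _ (ltnW mr) zm'.
  by rewrite raddfB /= zc (bd_bd (cone z)) subr0.
exists (cone z + d); last by rewrite [LHS]raddfD /= dE addrC subrK.
apply: ybelowD; first exact: ybelow_cone.
by move=> s ms; apply: dm; exact: ltnW.
Qed.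

End Acyclicity.

(** * Restriction of chains to the independence complex, and extension back *)

Section Restriction.
Variables (E : finType) (M : matroid E).
Local Notation D := (bergman M).
Local Notation IC := (indep_complex M).
Local Notation vertex := (E + {set E})%type.

(* The bracket of v in the independence complex when v takes values in the
   y-vertices, and 0 otherwise. *)
Definition ybracket n (v : 'I_n -> vertex) : chain IC n :=
  [ffun s : simplex IC n =>
     \sum_(w : 'S_n | [forall i, v i == inl (vert s (w i))]) (-1) ^+ w].

Lemma eq_ybracket n (v v' : 'I_n -> vertex) : v =1 v' -> ybracket v = ybracket v'.
Proof.
move=> Ev; apply/ffunP => s; rewrite !ffunE; apply: eq_bigl => w.
by apply: eq_forallb => i; rewrite Ev.
Qed.

Lemma ybracket_inl n (u : 'I_n -> E) : ybracket (inl \o u) = bracket IC u.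
Proof. by apply/ffunP => s; rewrite !ffunE. Qed.

Lemma ybracket_inr n (v : 'I_n -> vertex) i F : v i = inr F -> ybracket v = 0.
Proof.
move=> vi; apply/ffunP => s; rewrite !ffunE big_pred0 // => w.
by apply/forallP => /(_ i); rewrite vi.
Qed.

Lemma inl_or_inr n (v : 'I_n -> vertex) :
  (exists u : 'I_n -> E, v =1 inl \o u) \/ (exists i F, v i = inr F).
Proof.
have [/existsP[i]|/existsPn N] := boolP [exists i, if v i is inr _ then true else false].
  by case vi: (v i) => [|F] // _; right; exists i, F.
have H i : exists x, v i == inl x.
  by have := N i; case: (v i) => // x _; exists x.
by left; exists (fun i => xchoose (H i)) => i; apply/eqP; exact: (xchooseP (H i)).
Qed.

Lemma bergman_inl (I : {set E}) : (inl @: I \in faces D) = (I \in faces IC).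
Proof.
have yE : ypart (inl @: I : {set vertex}) = I.
  by apply/setP => i; rewrite inE mem_imset //; exact: inl_inj.
have xE F : (F \in xpart (inl @: I : {set vertex})) = false.
  by rewrite inE; apply/imsetP => -[].
rewrite inE yE; case: (I \in indep M) => //=.
by apply/andP; split; apply/forall_inP => F; rewrite xE.
Qed.

(** In general not a chain map: a simplex with an x-vertex is sent to 0, but one of its faces may
    consist of y-vertices only. Going through [ybracket] takes care of the sign between the
    reference orderings of the two vertex sets. *)
Definition yrestrict n (c : chain D n) : chain IC n :=
  \sum_(s : simplex D n) ybracket (vert s) *~ c s.

Definition yextend n (c : chain IC n) : chain D n :=
  \sum_(s : simplex IC n) bracket D (inl \o vert s) *~ c s.

Lemma yrestrict_is_zmod_morphism n : zmod_morphism (@yrestrict n).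
Proof.
move=> c d; rewrite /yrestrict -sumrB; apply: eq_bigr => s _.
by rewrite !ffunE mulrzBr.
Qed.
HB.instance Definition _ n :=
  GRing.isZmodMorphism.Build (chain D n) (chain IC n) (@yrestrict n)
    (@yrestrict_is_zmod_morphism n).

Lemma yextend_is_zmod_morphism n : zmod_morphism (@yextend n).
Proof.
move=> c d; rewrite /yextend -sumrB; apply: eq_bigr => s _.
by rewrite !ffunE mulrzBr.
Qed.
HB.instance Definition _ n :=
  GRing.isZmodMorphism.Build (chain IC n) (chain D n) (@yextend n)
    (@yextend_is_zmod_morphism n).

Lemma ybracket_perm n (v : 'I_n -> vertex) (w : 'S_n) :
  ybracket (v \o w) = ybracket v *~ (-1) ^+ w.
Proof.
have [[u Eu]|[i [F vi]]] := inl_or_inr v.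
  rewrite (eq_ybracket Eu) ybracket_inl -bracket_perm -ybracket_inl.
  by apply: eq_ybracket => i /=; rewrite Eu.
rewrite (ybracket_inr vi) mul0rz.
by apply: (@ybracket_inr _ _ (w^-1 i)%g F); rewrite /= permKV.
Qed.

Lemma yrestrict_bracket n (v : 'I_n -> vertex) :
  yrestrict (bracket D v) = ybracket v.
Proof.
have [[s [w Ev]]|[-> N]] := bracketP D v.
  rewrite (eq_bracket D Ev) (eq_ybracket Ev) bracket_perm raddfMz /=.
  by rewrite [yrestrict _]bracket_lin ybracket_perm.
rewrite raddf0; have [[u Eu]|[i [F vi]]] := inl_or_inr v; last first.
  by rewrite (ybracket_inr vi).
rewrite (eq_ybracket Eu) ybracket_inl bracket_eq0 // => -[uI uD]; case: N.
split; first by move=> i j; rewrite !Eu /= => -[/uI].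
by rewrite (eq_imset _ Eu) imset_comp bergman_inl.
Qed.

Lemma yextend_bracket n (u : 'I_n -> E) :
  yextend (bracket IC u) = bracket D (inl \o u).
Proof.
have [[s [w Eu]]|[-> N]] := bracketP IC u.
  rewrite (eq_bracket IC Eu) bracket_perm raddfMz /=.
  rewrite [yextend _]bracket_lin -bracket_perm.
  by apply: eq_bracket => i /=; rewrite Eu.
rewrite raddf0 bracket_eq0 // => -[uI uD]; case: N; split.
  by move=> i j E1; apply: uI; rewrite /= E1.
by rewrite -bergman_inl -imset_comp.
Qed.

Lemma yrestrictK n (c : chain IC n) : yrestrict (yextend c) = c.
Proof.
rewrite [RHS]chainE [yextend c]/yextend raddf_sum; apply: eq_bigr => s _.
by rewrite raddfMz /= yrestrict_bracket ybracket_inl.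
Qed.

(** A simplex of n vertices can contribute only if all n are y-vertices, and there c vanishes. *)
Lemma yrestrict_below n (c : chain D n) : ybelow n c -> yrestrict c = 0.
Proof.
move=> C; rewrite /yrestrict big1 // => s _.
have [[u Eu]|[i [F vi]]] := inl_or_inr (vert s); last first.
  by rewrite (ybracket_inr vi) mul0rz.
rewrite C ?mulr0z // -vert_im (eq_imset _ Eu) (imset_comp inl).
have -> : ypart (inl @: (u @: 'I_n) : {set vertex}) = u @: 'I_n.
  by apply/setP => i; rewrite inE mem_imset //; exact: inl_inj.
rewrite card_imset ?card_ord // => i j uij.
by apply: (@vert_inj _ _ _ s); rewrite !Eu /= uij.
Qed.

Lemma ypart_lt n (v : 'I_n -> vertex) i F :
  v i = inr F -> (#|ypart (v @: 'I_n)| < n)%N.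
Proof.
move=> vi; rewrite -(card_imset _ (@inl_inj E {set E})).
have lt : inl @: ypart (v @: 'I_n) \proper v @: 'I_n.
  apply/properP; split.
    by apply/subsetP => _ /imsetP[x + ->]; rewrite inE.
  exists (inr F); first by apply/imsetP; exists i.
  by apply/imsetP => -[].
apply: leq_trans (proper_card lt) _.
by apply: leq_trans (leq_imset_card _ _) _; rewrite card_ord.
Qed.

(** Extending the restriction gives back a simplex of y-vertices only; a simplex with some x_F
    restricts to 0 and has fewer than n y-vertices. *)
Lemma below_yextend n (c : chain D n) : ybelow n (c - yextend (yrestrict c)).
Proof.
rewrite [X in ybelow _ (X - _)]chainE [yrestrict c]/yrestrict.
rewrite [yextend _](raddf_sum (@yextend n)) -sumrB; apply: ybelow_sum => s.
rewrite raddfMz /= -mulrzBl; apply: ybelowMz.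
have [[u Eu]|[i [F vi]]] := inl_or_inr (vert s).
  rewrite (eq_bracket D Eu) (eq_ybracket Eu) ybracket_inl yextend_bracket subrr.
  exact: ybelow0.
rewrite (ybracket_inr vi) raddf0 subr0; apply: ybelow_bracket.
exact: ypart_lt vi.
Qed.

(** The action preserves the two kinds of vertices, and on the y-vertices it is the action of g on
    E. *)
Lemma yrestrict_act n (g : {perm E}) (c : chain D n) : g \in matroid_aut M ->
  yrestrict (chain_act (bergman_perm g) c) = chain_act g (yrestrict c).
Proof.
move=> gM; rewrite [chain_act _ c]/chain_act [yrestrict c]/yrestrict.
rewrite !raddf_sum; apply: eq_bigr => s _; rewrite !raddfMz /=; congr (_ *~ _).
rewrite yrestrict_bracket.
have [[u Eu]|[i [F vi]]] := inl_or_inr (vert s).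
  rewrite [in RHS](eq_ybracket Eu) ybracket_inl.
  rewrite (chain_act_bracket _ (indep_simp_aut gM)).
  rewrite -ybracket_inl; apply: eq_ybracket => i.
  by rewrite /= Eu permE.
rewrite [in RHS](ybracket_inr vi) raddf0; apply: (@ybracket_inr _ _ i (g @: F)).
by rewrite /= vi permE.
Qed.

Lemma chain_top n (c : chain D n) : (rank M [set: E] < n)%N -> c = 0.
Proof.
move=> rn; apply/ffunP => s; have := bergman_card (simplex_faces s).
by rewrite simplex_card leqNgt rn.
Qed.

(** A cycle with zero restriction lives on simplices whose y-part is not a basis, so by acyclicity
    it bounds some d; but d sits above the top dimension, hence d = 0. *)
Lemma yrestrict_cycle_eq0 n (z : chain D n) :
  rank M [set: E] = n -> bd z = 0 -> yrestrict z = 0 -> z = 0.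
Proof.
move=> rn zc z0; have := below_yextend z; rewrite z0 raddf0 subr0 => zn.
have [|d _ <-] := ybelow_acyclic _ zn zc; first by rewrite rn.
by rewrite (chain_top d) ?rn // raddf0.
Qed.

(** The boundary of the extension of c is filled, by acyclicity, with a chain d of zero restriction;
    subtracting d gives the required cycle. *)
Lemma yrestrict_cycle_surj n (c : chain IC n) : rank M [set: E] = n ->
  exists2 z : chain D n, bd z = 0 & yrestrict z = c.
Proof.
case: n c => [|n] c rn.
  (* For r(M) = 0 the map [bd] is zero on [chain 0], so the extension is already a cycle. *)
  exists (yextend c); last exact: yrestrictK.
  rewrite /bd big1 // => s _; rewrite big1 ?mul0rz // => -[] //.
have [| | |d dn dE] := @ybelow_acyclic E M n.+1 n (bd (yextend c)).
- by rewrite rn.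
(* A simplex of n vertices has at most n y-vertices, fewer than r(M) = n + 1. *)
- move=> t; rewrite leqNgt ltnS -[X in (_ <= X)%N](simplex_card t).
  rewrite -(card_imset (ypart _) (@inl_inj E {set E})) subset_leq_card //.
  by apply/subsetP => _ /imsetP[x + ->]; rewrite inE.
- exact: (bd_bd (yextend c)).
exists (yextend c - d); first by rewrite [LHS]raddfB /= dE subrr.
by rewrite raddfB /= yrestrictK yrestrict_below // subr0.
Qed.

End Restriction.

(** * Top homology as the group of top cycles *)

Section TopHomology.
Variables (V : finType) (D : complex V) (n : nat).
Hypothesis top : forall c : chain D n.+1, c = 0.
Local Open Scope quotient_scope.

(** Without nonzero chains one degree up the only boundary is 0, so a class contains a single cycle
    and the choice made by [repr] is forced. *)
Lemma repr_homologyK (z : Defs.cycle D n) : repr (\pi_(homology D n) z) = z.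
Proof.
apply/eqP; rewrite -subr_eq0; apply/eqP/val_inj.
have : repr (\pi_(homology D n) z) - z \in @boundaries _ D n.
  by rewrite Quotient.idealrBE reprK.
by move=> /asboolP[c <-]; rewrite (top c) raddf0.
Qed.

Definition homology_cycle (x : homology D n) : chain D n := val (repr x).

Lemma homology_cycle_is_zmod_morphism : zmod_morphism homology_cycle.
Proof.
move=> x y; rewrite /homology_cycle -[x]reprK -[y]reprK.
rewrite -[\pi _ - _]raddfB !repr_homologyK.
exact: (raddfB (val : Defs.cycle D n -> chain D n)).
Qed.

End TopHomology.

(** * The isomorphism and its equivariance *)

Theorem corollary1p3 (E : finType) (M : matroid E) :
  exists phi : {additive homology (bergman M) (rank M [set: E]) ->
                         chain (indep_complex M) (rank M [set: E])},
    bijective phi /\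
    forall (g : {perm E}) (gM : g \in matroid_aut M)
           (x : homology (bergman M) (rank M [set: E])),
      phi (homology_act (bergman_simp_aut gM) x) = chain_act g (phi x).
Proof.
pose n := rank M [set: E].
have top (c : chain (bergman M) n.+1) : c = 0 by exact: chain_top.
have fB : zmod_morphism (fun x => yrestrict (@homology_cycle _ (bergman M) n x)).
  by move=> x y; rewrite homology_cycle_is_zmod_morphism // raddfB.
pose f : {additive homology (bergman M) n -> chain (indep_complex M) n} :=
  HB.pack (fun x => yrestrict (@homology_cycle _ (bergman M) n x))
    (GRing.isZmodMorphism.Build _ _ _ fB).
exists f; split=> [|g gM x]; last first.
  rewrite -[RHS]yrestrict_act // /f /= /homology_cycle.
  by rewrite /homology_act repr_homologyK.
have fI : injective f.
  move=> x y xy; apply/eqP; rewrite -subr_eq0 -[_ - _]reprK.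
  (* The representative of x - y is a cycle whose restriction is f x - f y = 0. *)
  have -> : repr (x - y) = 0.
    apply: val_inj; apply: (@yrestrict_cycle_eq0 _ M n) => //.
      by have /eqP := valP (repr (x - y)).
    by have := raddfB f x y; rewrite xy subrr.
  by rewrite raddf0.
have fS c : exists x, f x == c.
  have [z zc <-] := yrestrict_cycle_surj c (erefl n).
  have zC : z \in @cycles _ (bergman M) n by apply/eqP.
  exists (\pi_(homology (bergman M) n)%qT (Sub z zC : Defs.cycle (bergman M) n)).
  by rewrite /f /= /homology_cycle repr_homologyK.
exists (fun c => xchoose (fS c)) => [x|c]; last exact/eqP/(xchooseP (fS c)).
by apply: fI; exact/eqP/(xchooseP (fS (f x))).
Qed.
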